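(* Let $f:M\to\mathbb{R}^3$ be a CMC surface ($H=1$) with Gauss map $N$, not the round sphere, and let $d^S_\lambda$ be the family of flat connections given by the conformal Gauss map $S$ of $f$. Let $\mu\in\mathbb{C}\setminus\{0,1\}$, $a=\frac{\mu+\mu^{-1}}2$, $b=i\frac{\mu^{-1}-\mu}2$. Then a section $\varphi$ of the trivial $\mathbb{H}^2$-bundle over $\tilde M$ is $d^S_\mu$-parallel if and only if $$\varphi=e(\alpha+n)+\psi\beta$$ with $n\in\mathbb{H}$ constant, $\alpha$ a $d^N_\mu$-parallel section and $\beta=\frac12(N\alpha(a-1)+\alpha b)$. Moreover, all $d^N_\mu$-parallel sections are obtained algebraically from $d^S_\mu$-parallel sections $\varphi=e\nu+\psi\beta$ by $$\alpha=N\beta-\beta\frac{b}{a-1}.$$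
   Context: $\mathbb{H}=\mathrm{span}_{\mathbb{R}}\{1,i,j,k\}=\mathbb{R}^4$, $\mathbb{R}^3=\mathrm{Im}\,\mathbb{H}$, $S^2=\{n\in \mathrm{Im}\,\mathbb{H}: n^2=-1\}$, $\mathbb{C}=\mathrm{span}_{\mathbb{R}}\{1,i\}$; complex scalars act on $\mathbb{H}$ and $\mathbb{H}^2=\mathbb{C}^4$ by right multiplication. $M$ is a Riemann surface with universal cover $\tilde M$; $*\omega(X)=\omega(JX)$. $e=\begin{pmatrix}1\\0\end{pmatrix}$, $\psi=\begin{pmatrix}f\\1\end{pmatrix}$. CMC surface with $H=1$: conformal immersion $f:M\to\mathbb{R}^3$ with Gauss map $N$ ($*df=N\,df=-df\,N$) and $df=-\frac12(dN-N*dN)$. Put $g=f+N$ and $N_g=-N$. CMC family: $d^N_\lambda\alpha=d\alpha+\frac12 df\,(N\alpha(a_\lambda-1)+\alpha b_\lambda)$ for $\alpha:\tilde M\to\mathbb{H}$, $\lambda\in\mathbb{C}\setminus\{0\}$, with $a_\lambda=\frac{\lambda+\lambda^{-1}}2$, $b_\lambda=i\frac{\lambda^{-1}-\lambda}2$. Constrained Willmore family: the conformal Gauss map of $f$ is $S=F\begin{pmatrix}N&0\\1&-N\end{pmatrix}F^{-1}$, $F=\begin{pmatrix}1&f\\0&1\end{pmatrix}$. Its associated family of flat connections on the trivial $\mathbb{C}^4$-bundle is $d^S_\lambda=d+(\lambda-1)\hat A^{(1,0)}+(\lambda^{-1}-1)\hat A^{(0,1)}$, where $*\hat A=\frac12\begin{pmatrix}0&f\\0&1\end{pmatrix}dg$,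 $\hat A^{(1,0)}=\frac12(\hat A-I*\hat A)$, $\hat A^{(0,1)}=\frac12(\hat A+I*\hat A)$ and $I$ is right multiplication by $i$. Explicitly, $d^S_\lambda(e\nu+\psi\beta)=d(e\nu+\psi\beta)+\frac12\psi\,dg\,(N_g\beta(a_\lambda-1)+\beta b_\lambda)$. *)

(* Defs.v *)
From HB Require Import structures.
From mathcomp Require Import all_boot all_order all_algebra.
From mathcomp Require Import all_classical all_reals all_analysis.
From mathcomp Require Import complex ring.

Set Implicit Arguments.
Unset Strict Implicit.
Unset Printing Implicit Defensive.

Import Order.TTheory GRing.Theory Num.Theory.
Import numFieldNormedType.Exports.

Local Open Scope classical_set_scope.
Local Open Scope ring_scope.

(* Real quaternions [q0 + q1 i + q2 j + q3 k], carried by the normed space R^4.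
   The norm inherited from ['rV_4] is the sup norm: it only serves to define
   limits and derivatives.  The Euclidean structure is [qdot]. *)
Definition quat (R : realType) : Type := 'rV[R]_4.

HB.instance Definition _ (R : realType) :=
  NormedModule.copy (quat R) 'rV[R]_4.

Section QuatRing.
Variable R : realType.
Implicit Types (p q r : quat R) (x y z t : R).

Definition mkquat x y z t : quat R :=
  \row_(l < 4) [:: x; y; z; t]`_l.

Definition q0 q : R := q 0 (inord 0).
Definition q1 q : R := q 0 (inord 1).
Definition q2 q : R := q 0 (inord 2).
Definition q3 q : R := q 0 (inord 3).

Lemma quatP p q :
  q0 p = q0 q -> q1 p = q1 q -> q2 p = q2 q -> q3 p = q3 q -> p = q.
Proof.
move=> e0 e1 e2 e3; apply/rowP => l.
by case: (ltnP l 4) (ltn_ord l) => // _ _;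
  case: l => [] [|[|[|[|//]]]] h;
  [move: e0|move: e1|move: e2|move: e3]; rewrite /q0 /q1 /q2 /q3;
  (set m := inord _; have -> : m = Ordinal h by apply/val_inj; rewrite /= inordK).
Qed.

Lemma q0E x y z t : q0 (mkquat x y z t) = x.
Proof. by rewrite /q0 mxE inordK. Qed.
Lemma q1E x y z t : q1 (mkquat x y z t) = y.
Proof. by rewrite /q1 mxE inordK. Qed.
Lemma q2E x y z t : q2 (mkquat x y z t) = z.
Proof. by rewrite /q2 mxE inordK. Qed.
Lemma q3E x y z t : q3 (mkquat x y z t) = t.
Proof. by rewrite /q3 mxE inordK. Qed.

Lemma q0D p q : q0 (p + q) = q0 p + q0 q. Proof. by rewrite /q0 mxE. Qed.
Lemma q1D p q : q1 (p + q) = q1 p + q1 q. Proof. by rewrite /q1 mxE. Qed.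
Lemma q2D p q : q2 (p + q) = q2 p + q2 q. Proof. by rewrite /q2 mxE. Qed.
Lemma q3D p q : q3 (p + q) = q3 p + q3 q. Proof. by rewrite /q3 mxE. Qed.

Lemma q0Z x q : q0 (x *: q) = x * q0 q. Proof. by rewrite /q0 mxE. Qed.
Lemma q1Z x q : q1 (x *: q) = x * q1 q. Proof. by rewrite /q1 mxE. Qed.
Lemma q2Z x q : q2 (x *: q) = x * q2 q. Proof. by rewrite /q2 mxE. Qed.
Lemma q3Z x q : q3 (x *: q) = x * q3 q. Proof. by rewrite /q3 mxE. Qed.

Definition qmul p q : quat R := mkquat
  (q0 p * q0 q - q1 p * q1 q - q2 p * q2 q - q3 p * q3 q)
  (q0 p * q1 q + q1 p * q0 q + q2 p * q3 q - q3 p * q2 q)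
  (q0 p * q2 q - q1 p * q3 q + q2 p * q0 q + q3 p * q1 q)
  (q0 p * q3 q + q1 p * q2 q - q2 p * q1 q + q3 p * q0 q).

Definition qone : quat R := mkquat 1 0 0 0.

Definition qE :=
  (q0E, q1E, q2E, q3E, (q0D, q1D, q2D, q3D), (q0Z, q1Z, q2Z, q3Z)).

Lemma qmulA : associative qmul.
Proof. by move=> p q r; apply: quatP; rewrite /qmul !qE; ring. Qed.
Lemma qmul1 : left_id qone qmul.
Proof. by move=> p; apply: quatP; rewrite /qmul /qone !qE; ring. Qed.
Lemma qmulr1 : right_id qone qmul.
Proof. by move=> p; apply: quatP; rewrite /qmul /qone !qE; ring. Qed.
Lemma qmulDl : left_distributive qmul +%R.
Proof. by move=> p q r; apply: quatP; rewrite /qmul !qE; ring. Qed.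
Lemma qmulDr : right_distributive qmul +%R.
Proof. by move=> p q r; apply: quatP; rewrite /qmul !qE; ring. Qed.
Lemma qone_neq0 : qone != 0.
Proof.
apply/eqP => /(congr1 q0); rewrite /qone q0E /q0 mxE => /eqP.
by rewrite oner_eq0.
Qed.

HB.instance Definition _ := GRing.Zmodule_isNzRing.Build (quat R)
  qmulA qmul1 qmulr1 qmulDl qmulDr qone_neq0.

Lemma qscaleAl x p q : x *: (p * q) = (x *: p) * q.
Proof. by apply: quatP; rewrite /GRing.mul /= /qmul !qE; ring. Qed.
Lemma qscaleAr x p q : x *: (p * q) = p * (x *: q).
Proof. by apply: quatP; rewrite /GRing.mul /= /qmul !qE; ring. Qed.

HB.instance Definition _ :=
  GRing.Lmodule_isLalgebra.Build R (quat R) qscaleAl.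
HB.instance Definition _ :=
  GRing.Lalgebra_isAlgebra.Build R (quat R) qscaleAr.

Definition qdot p q : R := q0 p * q0 q + q1 p * q1 q + q2 p * q2 q + q3 p * q3 q.

Definition imH : set (quat R) := [set q | q0 q = 0].

Definition S2 : set (quat R) := [set n | imH n /\ n * n = -1].

(* The inclusion of C = span {1, i} in H. *)
Definition c2q (z : R[i]) : quat R := mkquat (complex.Re z) (complex.Im z) 0 0.

End QuatRing.

Section Plane.
Variable R : realType.

(* The complex plane as a real normed space: (x, y) stands for x + iy. *)
Definition plane : normedModType R := (R * R)%type.

Definition mulI (v : plane) : plane := (- v.2, v.1).

Fixpoint Ck (V : normedModType R) (k : nat) (U : set plane) (g : plane -> V) :
    Prop :=
  if k is k'.+1 then
    (forall z, U z -> differentiable g z) /\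
    (forall v : plane, Ck k' U (fun z => 'D_v g z))
  else forall z, U z -> {for z, continuous g}.

Definition smooth_on (V : normedModType R) (U : set plane) (g : plane -> V) :
    Prop :=
  forall k, Ck k U g.

(* Smoothness follows from the complex linearity of the differential
   (Goursat), so requiring it does not restrict the notion. *)
Definition holomorphic_on (U : set plane) (g : plane -> plane) : Prop :=
  smooth_on U g /\
  forall z v : plane, U z -> 'D_(mulI v) g z = mulI ('D_v g z).

End Plane.

(* A chart is a homeomorphism between an open subset of [T] and an open subset
   of the plane; [coord] and [param] are unconstrained elsewhere. *)
Record chart (R : realType) (T : topologicalType) := Chart {
  dom : set T;
  coord : T -> plane R;
  param : plane R -> T;
  dom_open : open dom;
  img_open : open (coord @` dom);
  coordK : forall x, dom x -> param (coord x) = x;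
  coord_continuous : {within dom, continuous coord};
  param_continuous : {within coord @` dom, continuous param} }.

Record riemannSurface (R : realType) := RiemannSurface {
  carrier :> topologicalType;
  atlas : set (chart R carrier);
  atlas_cover : forall x : carrier, exists2 c, atlas c & dom c x;
  atlas_compatible : forall c c', atlas c -> atlas c' ->
    holomorphic_on (coord c @` (dom c `&` dom c')) (coord c' \o param c);
  surface_nonempty : [set: carrier] !=set0;
  surface_hausdorff : hausdorff_space carrier;
  surface_connected : connected [set: carrier] }.

Section Surface.
Variables (R : realType) (M : riemannSurface R).

Definition smooth (V : normedModType R) (h : M -> V) : Prop :=
  forall c, atlas c -> smooth_on (coord c @` dom c) (h \o param c).

(* A tangent vector at [foot], given by its components [vec] in a chart of the
   atlas.  One-forms are evaluated on all such representatives. *)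
Record tangent := Tangent {
  tchart : chart R M;
  tchart_atlas : atlas tchart;
  foot : M;
  foot_dom : dom tchart foot;
  vec : plane R }.

Definition J (X : tangent) : tangent :=
  Tangent (tchart_atlas X) (foot_dom X) (mulI (vec X)).

Definition d (V : normedModType R) (h : M -> V) (X : tangent) : V :=
  'D_(vec X) (h \o param (tchart X)) (coord (tchart X) (foot X)).

Definition star (V : Type) (w : tangent -> V) (X : tangent) : V := w (J X).

End Surface.

Section UniversalCover.
Variable R : realType.

Definition holomorphic (M M' : riemannSurface R) (p : M -> M') : Prop :=
  continuous p /\
  forall c c', atlas c -> atlas c' ->
    holomorphic_on (coord c @` (dom c `&` p @^-1` dom c'))
                   (coord c' \o p \o param c).

Definition covering_map (T B : topologicalType) (p : T -> B) : Prop :=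
  [/\ continuous p,
      range p = [set: B] &
      forall b : B, exists U : set B, exists sheets : set (set T),
        [/\ open U /\ U b,
            \bigcup_(V in sheets) V = p @^-1` U,
            trivIset sheets id &
            forall V, sheets V -> open V /\
              exists s : B -> T,
                [/\ {within U, continuous s}, s @` U = V,
                    forall y, U y -> p (s y) = y &
                    forall x, V x -> s (p x) = x]]].

Definition simply_connected (T : topologicalType) : Prop :=
  (forall x y : T, exists gamma : R -> T,
     [/\ {within `[0, 1], continuous gamma}, gamma 0 = x & gamma 1 = y]) /\
  (forall gamma : R -> T,
     {within `[0, 1], continuous gamma} -> gamma 0 = gamma 1 ->
     exists h : R * R -> T,
       [/\ {within `[0, 1] `*` `[0, 1], continuous h},
           forall t, t \in `[0, 1] -> h (0, t) = gamma t,
           forall t, t \in `[0, 1] -> h (1, t) = gamma 0 &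
           forall s, s \in `[0, 1] -> h (s, 0) = gamma 0 /\ h (s, 1) = gamma 0]).

Definition universal_cover (Mt M : riemannSurface R) (p : Mt -> M) : Prop :=
  [/\ simply_connected Mt, covering_map p & holomorphic p].

End UniversalCover.

Section CMC.
Variables (R : realType) (M : riemannSurface R).
Notation H := (quat R).
Implicit Types f N : M -> H.

Definition conformal_immersion f : Prop :=
  [/\ smooth f,
      forall x, imH (f x),
      forall X : tangent M, vec X != 0 -> d f X != 0 &
      forall X : tangent M,
        qdot (d f (J X)) (d f X) = 0 /\
        qdot (d f (J X)) (d f (J X)) = qdot (d f X) (d f X)].

Definition gauss_map f N : Prop :=
  [/\ smooth N,
      forall x, S2 (N x) &
      forall X, star (d f) X = N (foot X) * d f X /\
                star (d f) X = - (d f X * N (foot X))].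

Definition cmc1 f N : Prop :=
  [/\ conformal_immersion f, gauss_map f N &
      forall X, d f X = - (2^-1 *: (d N X - N (foot X) * star (d N) X))].

Definition in_round_sphere f : Prop :=
  exists c : H, exists r : R,
    [/\ imH c, 0 < r & forall x, qdot (f x - c) (f x - c) = r ^+ 2].

End CMC.

Section Families.
Variables (R : realType) (M : riemannSurface R).
Notation H := (quat R).
Implicit Types (f N alpha : M -> H) (phi : M -> H * H) (lambda : R[i]).

Definition coefa lambda : R[i] := (lambda + lambda^-1) / 2.
Definition coefb lambda : R[i] := 'i * (lambda^-1 - lambda) / 2.

Definition dN f N lambda alpha (X : tangent M) : H :=
  let x := foot X in
  d alpha X + 2^-1 *: (d f X *
    (N x * alpha x * c2q (coefa lambda - 1) + alpha x * c2q (coefb lambda))).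

Definition dN_parallel f N lambda alpha : Prop :=
  smooth alpha /\ forall X, dN f N lambda alpha X = 0.

(* Right multiplication of a vector of H^2, written as a pair, by a scalar. *)
Definition rmul (v : H * H) (q : H) : H * H := (v.1 * q, v.2 * q).

Definition e : H * H := (1, 0).
Definition psi f (x : M) : H * H := (f x, 1).

(* The value at [X] of the one-form [*Ahat], an endomorphism of H^2:
   the product of half the matrix [(0, f; 0, 1)] with the scalar [dg X]. *)
Definition starAhat f N (X : tangent M) (v : H * H) : H * H :=
  let g := f \+ N in
  2^-1 *: (f (foot X) * d g X * v.2, d g X * v.2).

(* [** = - id] on one-forms *)
Definition Ahat f N (X : tangent M) (v : H * H) : H * H :=
  - star (starAhat f N) X v.

Definition Ahat10 f N (X : tangent M) (v : H * H) : H * H :=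
  2^-1 *: (Ahat f N X v - rmul (starAhat f N X v) (c2q 'i)).

Definition Ahat01 f N (X : tangent M) (v : H * H) : H * H :=
  2^-1 *: (Ahat f N X v + rmul (starAhat f N X v) (c2q 'i)).

(* Complex scalars act on H^2 from the right. *)
Definition dS f N lambda phi (X : tangent M) : H * H :=
  let v := phi (foot X) in
  d phi X + rmul (Ahat10 f N X v) (c2q (lambda - 1))
          + rmul (Ahat01 f N X v) (c2q (lambda^-1 - 1)).

Definition dS_parallel f N lambda phi : Prop :=
  smooth phi /\ forall X, dS f N lambda phi X = 0.

End Families.

Arguments e {R}.

(* Main.v *)
Require Import Defs.
From HB Require Import structures.
From mathcomp Require Import all_boot all_order all_algebra.
From mathcomp Require Import all_classical all_reals all_analysis.
From mathcomp Require Import complex ring.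
(* [coord] and [coord_continuous] are shadowed by MathComp. *)
Import Defs.

Import Order.TTheory GRing.Theory Num.Theory.
Import numFieldNormedType.Exports.

Set Implicit Arguments.
Unset Strict Implicit.
Unset Printing Implicit Defensive.

Local Open Scope classical_set_scope.
Local Open Scope ring_scope.

(** Since [(a - 1)^2 + b^2 = - 2 (a - 1)] and [N^2 = -1], the pointwise maps
    [alpha |-> (N alpha (a - 1) + alpha b) / 2] and
    [beta |-> N beta - beta b / (a - 1)] are mutually inverse.  In the frame
    [e, psi] a section [(nu, beta)] is [d^S]-parallel iff [d nu = - df beta] and
    [d beta = dg alpha (a - 1) / 2], while [alpha] is [d^N]-parallel iff
    [d alpha = - df beta].  As [N] anticommutes with [df] and [dN], the equation
    for [beta] is equivalent to the one for [alpha], and then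
    [d (nu - alpha) = 0], so [nu - alpha] is constant on the connected surface.
    The hypotheses on [f] and [N] pass to the cover by the chain rule. *)

(** * Derivatives of linear, bilinear, paired and composed maps *)

Section Linear.
Variables (R : realType).
Implicit Types U V W : normedModType R.

(** Lets [Ck_bilin] treat a real function times a vector-valued one, as the chain rule [Ck_comp]
    requires. *)
Lemma scale_bilinear V : bilinear_for
    (GRing.Scale.Law.clone _ _ *:%R _) (GRing.Scale.Law.clone _ _ *:%R _)
    (@GRing.scale R V : R^o -> V -> V).
Proof.
split=> [u'|u] a x y /=.
- by rewrite scalerDl scalerA.
- by rewrite scalerDr !scalerA mulrC.
Qed.

HB.instance Definition _ V :=
  bilinear_isBilinear.Build R R^o V V _ _ _ (scale_bilinear V).

(** A first-order expansion of [f] at [a] is also one of [g], so by uniqueness ['d f a] is the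
    differential of [g]. *)
Lemma near_eq_differentiable V W (f g : V -> W) (a : V) :
  (\near a, f a = g a) -> differentiable f a -> differentiable g a.
Proof.
move=> fg df.
have ex : g \o shift a = cst (g a) + 'd f a +o_ 0 id.
  apply/eqaddoP => _/posnumP[eps].
  have /eqaddoP/(_ eps%:num)/(_ (gt0 eps)) := diff_locally df.
  have : \forall y \near (0 : V), f (y + a) = g (y + a).
    move: fg; rewrite nbhs0P; apply: filterS => y /=.
    by rewrite addrC.
  apply: filterS2 => y fgy.
  have -> // : (f \o shift a - (cst (f a) + 'd f a)) y =
               (g \o shift a - (cst (g a) + 'd f a)) y.
  change (f (y + a) - (f a + 'd f a y) = g (y + a) - (g a + 'd f a y)).
  by rewrite fgy (nbhs_singleton fg).
apply/diff_locallyP.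
rewrite (@diff_unique _ _ _ g ('d f a) a) //.
  by split => //; apply: diff_continuous.
exact: diff_continuous.
Qed.

Lemma derive_lin V W W' (L : {linear W -> W'}) (g : V -> W) z v :
  continuous L -> differentiable g z ->
  differentiable (L \o g) z /\ 'D_v (L \o g) z = L ('D_v g z).
Proof.
move=> Lc dg.
have dL : differentiable L (g z) by exact: linear_differentiable.
split; first exact: differentiable_comp.
rewrite !deriveE //; last exact: differentiable_comp.
by rewrite diff_comp //= diff_lin.
Qed.

Lemma derive_bilin V U W W' (B : {bilinear U -> W -> W'})
    (g : V -> U) (h : V -> W) z v :
  continuous (fun p => B p.1 p.2) -> differentiable g z -> differentiable h z ->
  differentiable (fun x => B (g x) (h x)) z /\
  'D_v (fun x => B (g x) (h x)) z = B ('D_v g z) (h z) + B (g z) ('D_v h z).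
Proof.
move=> Bc dg dh.
pose gh x := (g x, h x).
pose Bp (p : U * W) := B p.1 p.2.
have dgh : differentiable gh z by exact: differentiable_pair.
have dB : differentiable Bp (gh z) by exact: differentiable_bilin.
have dBgh : differentiable (Bp \o gh) z by exact: differentiable_comp.
split => //.
rewrite (deriveE _ dBgh) !deriveE // diff_comp //= diff_bilin // diff_pair //=.
by rewrite addrC.
Qed.

Lemma derive_pair V W W' (g : V -> W) (h : V -> W') z v :
  differentiable g z -> differentiable h z ->
  'D_v (fun x => (g x, h x)) z = ('D_v g z, 'D_v h z).
Proof.
move=> dg dh; rewrite !deriveE ?diff_pair //; exact: differentiable_pair.
Qed.

Lemma derive_comp V W W' (g : W -> W') (h : V -> W) z v :
  differentiable h z -> differentiable g (h z) ->
  'D_v (g \o h) z = 'D_('D_v h z) g (h z).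
Proof.
move=> dh dg; have dgh := differentiable_comp dh dg.
by rewrite (deriveE _ dgh) (deriveE _ dg) (deriveE _ dh) diff_comp.
Qed.

End Linear.

(** * Closure properties of C^k maps on the plane *)

Section SmoothPlane.
Variables (R : realType).
Implicit Types (V W : normedModType R) (k : nat) (U : set (plane R)).

(** Limits and derivatives in [Ck] are taken in the whole plane and not within [U], so the condition
    can be checked one point at a time. *)
Lemma Ck_pointwise V k U (g : plane R -> V) :
  Ck k U g <-> forall z, U z -> Ck k [set z] g.
Proof.
elim: k g => [|k IH] g /=.
  by split => h z Uz; [move=> _ ->; exact: h | exact: (h z Uz)].
split => [[dg Dg] z Uz|h].
  split => [_ ->|v]; first exact: dg.
  exact: (IH _).1.
split => [z Uz|v]; first by case: (h z Uz) => dz _; exact: dz.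
by apply/IH => z Uz; have [_] := h z Uz; apply.
Qed.

Lemma Ck_sub V k U U' (g : plane R -> V) : U `<=` U' -> Ck k U' g -> Ck k U g.
Proof. by rewrite !(Ck_pointwise k _ g) => UU' h z /UU'; exact: h. Qed.

(** Openness of [U] makes the two maps agree near each of its points, hence so do their derivatives
    of every order. *)
Lemma eq_Ck V k U (g h : plane R -> V) : open U ->
  (forall z, U z -> g z = h z) -> Ck k U g -> Ck k U h.
Proof.
move=> oU; elim: k g h => [|k IH] g h gh /=.
  move=> gc z Uz; rewrite /prop_for /continuous_at -(gh _ Uz).
  apply: cvg_trans (gc z Uz); apply: near_eq_cvg.
  by apply: filterS (open_nbhs_nbhs (conj oU Uz)) => y /gh.
have near_gh z : U z -> \forall x \near z, g x = h x.
  by move=> Uz; apply: filterS (open_nbhs_nbhs (conj oU Uz)) => y /gh.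
case=> dg Dg; split => [z Uz|v].
  exact: near_eq_differentiable (near_gh z Uz) (dg z Uz).
by apply: IH (Dg v) => z Uz; exact: near_eq_derive (near_gh z Uz).
Qed.

Lemma CkS V k U (g : plane R -> V) : Ck k.+1 U g -> Ck k U g.
Proof.
elim: k g => [|k IH] g [dg Dg].
  by move=> z Uz; apply: differentiable_continuous; exact: dg.
by split => // v; exact: IH.
Qed.

Lemma CkD V k U (g h : plane R -> V) : open U ->
  Ck k U g -> Ck k U h -> Ck k U (fun z => g z + h z).
Proof.
move=> oU; elim: k g h => [|k IH] g h /=.
  by move=> gc hc z Uz; apply: cvgD; [exact: gc | exact: hc].
move=> [dg Dg] [dh Dh]; split => [z Uz|v].
  by apply: differentiableD; [exact: dg | exact: dh].
apply: eq_Ck (IH _ _ (Dg v) (Dh v)) => // z Uz.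
by rewrite deriveD //; apply: diff_derivable; [exact: dg | exact: dh].
Qed.

Lemma Ck_lin V W k U (L : {linear V -> W}) (g : plane R -> V) :
  open U -> continuous L -> Ck k U g -> Ck k U (L \o g).
Proof.
move=> oU Lc; elim: k g => [|k IH] g /=.
  by move=> gc z Uz; apply: continuous_comp; [exact: gc | exact: Lc].
move=> [dg Dg]; split => [z Uz|v].
  by have [] := derive_lin 0 Lc (dg z Uz).
apply: eq_Ck (IH _ (Dg v)) => // z Uz /=.
by have [_ ->] := derive_lin v Lc (dg z Uz).
Qed.

(** Induction with the Leibniz rule; in each term [CkS] lowers the order of the undifferentiated
    factor. *)
Lemma Ck_bilin V V' W k U (B : {bilinear V -> V' -> W}) (g : plane R -> V)
    (h : plane R -> V') :
  open U -> continuous (fun p => B p.1 p.2) ->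
  Ck k U g -> Ck k U h -> Ck k U (fun z => B (g z) (h z)).
Proof.
move=> oU Bc; elim: k g h => [|k IH] g h.
  move=> gc hc z Uz.
  apply: (@continuous_comp _ _ _ (fun z => (g z, h z)) (fun p => B p.1 p.2)).
    by apply: cvg_pair; [exact: gc | exact: hc].
  exact: Bc.
move=> Cg Ch; have [dg Dg] := Cg; have [dh Dh] := Ch; split => [z Uz|v].
  by have [] := derive_bilin 0 Bc (dg z Uz) (dh z Uz).
have := CkD oU (IH _ _ (Dg v) (CkS Ch)) (IH _ _ (CkS Cg) (Dh v)).
apply: eq_Ck => // z Uz.
by have [_ ->] := derive_bilin v Bc (dg z Uz) (dh z Uz).
Qed.

Lemma Ck_pair V W k U (g : plane R -> V) (h : plane R -> W) :
  open U -> Ck k U g -> Ck k U h -> Ck k U (fun z => (g z, h z)).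
Proof.
move=> oU; elim: k g h => [|k IH] g h.
  by move=> gc hc z Uz; apply: cvg_pair; [exact: gc|exact: hc].
move=> [dg Dg] [dh Dh]; split => [z Uz|v].
  by apply: differentiable_pair; [exact: dg|exact: dh].
apply: eq_Ck (IH _ _ (Dg v) (Dh v)) => // z Uz.
by rewrite derive_pair; [|exact: dg|exact: dh].
Qed.

(** [Ck] controls derivatives in fixed directions, while the chain rule produces the varying
    direction ['D_v h z]; partial derivatives separate the two. *)
Lemma derive_plane V (g : plane R -> V) z (v : plane R) :
  differentiable g z ->
  'D_v g z =
    v.1 *: 'D_((1, 0) : plane R) g z + v.2 *: 'D_((0, 1) : plane R) g z.
Proof.
move=> dg; rewrite !deriveE // -!linearZ -linearD /=.
congr ('d g z _); case: v => x y.
change ((x, y) = (x * 1 + y * 0, x * 0 + y * 1)).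
by rewrite !mulr1 !mulr0 addr0 add0r.
Qed.

Lemma Ck_comp V k U U' (g : plane R -> V) (h : plane R -> plane R) :
  open U' -> (forall z, U' z -> U (h z)) ->
  Ck k U g -> Ck k U' h -> Ck k U' (g \o h).
Proof.
move=> oU' hU; elim: k g => [|k IH] g.
  by move=> gc hc z Uz; apply: continuous_comp; [exact: hc | exact/gc/hU].
move=> Cg Ch; have [dg Dg] := Cg; have [dh Dh] := Ch.
split => [z Uz|v].
  by apply: differentiable_comp; [exact: dh | exact/dg/hU].
have sc : continuous (fun p : R^o * V => p.1 *: p.2).
  by move=> p; exact: scale_continuous.
(* The derivative of the composite is a sum of components of ['D_v h] times partial derivatives of
   [g] along [h]; the induction hypothesis covers the latter. *)
apply: (@eq_Ck _ _ _ (fun z =>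
    ('D_v h z).1 *: ('D_((1, 0) : plane R) g \o h) z
  + ('D_v h z).2 *: ('D_((0, 1) : plane R) g \o h) z)) => //.
  move=> z Uz; rewrite derive_comp; [|exact: dh|exact/dg/hU].
  by rewrite (derive_plane _ (dg _ (hU _ Uz))).
have Ch' := CkS Ch.
have fstc : continuous (fst : R^o * R^o -> R^o) by move=> ?; exact: cvg_fst.
have sndc : continuous (snd : R^o * R^o -> R^o) by move=> ?; exact: cvg_snd.
apply: CkD => //.
  apply: (Ck_bilin (B := @GRing.scale R V : {bilinear R^o -> V -> V})) => //.
    exact: (@Ck_lin (plane R) R^o k U' fst _ oU' fstc (Dh v)).
  exact: IH (Dg _) Ch'.
apply: (Ck_bilin (B := @GRing.scale R V : {bilinear R^o -> V -> V})) => //.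
  exact: (@Ck_lin (plane R) R^o k U' snd _ oU' sndc (Dh v)).
exact: IH (Dg _) Ch'.
Qed.

End SmoothPlane.

(** * Vanishing derivatives and local constancy *)

Section LocallyConstant.
Variable R : realType.

(** The mean value theorem is applied on the segment from [z] to a point of a ball inside [U]; the
    functional [L] makes the values real. *)
Lemma derive0_locally_constant (V : normedModType R) (U : set (plane R))
    (g : plane R -> V) (L : {linear V -> R^o}) z :
  open U -> U z -> continuous L ->
  (forall y, U y -> differentiable g y) -> (forall v y, U y -> 'D_v g y = 0) ->
  \forall y \near z, L (g y) = L (g z).
Proof.
move=> oU Uz Lc dg Dg0.
have /nbhs_ballP[r /= r0 rU] := open_nbhs_nbhs (conj oU Uz).
apply/nbhs_ballP; exists r => //= y.
rewrite -ball_normE /= => yr.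
pose gam (t : R) : plane R := z + t *: (y - z).
have gamU t : 0 <= t <= 1 -> U (gam t).
  move=> /andP[t0 t1]; apply: rU; rewrite -ball_normE /= /gam opprD addNKr.
  rewrite normrN normrZ (ger0_norm t0) distrC.
  by apply: le_lt_trans yr; rewrite ler_piMl.
have dgam (t : R) : is_derive t 1 gam (y - z).
  rewrite -[y - z]add0r -[X in _ + X]scale1r; apply: is_deriveD.
  have dz : is_diff t (fun s : R^o => s *: (y - z))
                      (fun s : R^o => s *: (y - z)).
    exact: is_diff_scalel.
  apply: DeriveDef; first exact/diff_derivable/ex_diff.
  by rewrite deriveE ?diff_val //; exact: ex_diff.
have dphi (t : R) : 0 <= t <= 1 ->
    is_derive t 1 (L \o (g \o gam) : R -> R) (cst 0 t).
  move=> t01.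
  have dgam_t : differentiable gam t by apply/derivable1_diffP; case: (dgam t).
  have dg_t := dg _ (gamU t t01).
  have dgg := differentiable_comp dgam_t dg_t.
  have [dL DL] := derive_lin (1 : R^o) Lc dgg.
  apply: DeriveDef; first exact: diff_derivable.
  by rewrite DL derive_comp // Dg0 ?linear0 //; exact: gamU.
have [||t _] := @MVT_segment R (L \o (g \o gam)) (cst 0) 0 1 ler01.
- move=> t /[!in_itv] /= /andP[/ltW t0 /ltW t1]; apply: dphi.
  by rewrite t0.
- apply: derivable_within_continuous => t /[!in_itv] /= t01.
  by case: (dphi t t01).
rewrite /= mul0r => /eqP; rewrite subr_eq0 => /eqP.
by rewrite /gam scale1r scale0r addr0 addrC subrK.
Qed.

End LocallyConstant.

(** * The quaternion product as a continuous bilinear map, and the embedding of C *)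

Section Quaternions.
Variable R : realType.
Notation H := (quat R).
Implicit Types p q : H.

(** Typed in [R^o] so that the coordinates are functionals to which [derive0_locally_constant]
    applies. *)
Definition qcoord (l : 'I_4) q : R^o := q 0 l.

Lemma qcoord_linear l : linear (qcoord l).
Proof. by move=> a p q; rewrite /qcoord !mxE. Qed.

HB.instance Definition _ l :=
  GRing.isLinear.Build R H R^o _ (qcoord l) (qcoord_linear l).

Lemma qcoord_continuous l : continuous (qcoord l).
Proof. exact: matrix_normedtype.coord_continuous. Qed.

Lemma qmul_bilinear : bilinear_for
    (GRing.Scale.Law.clone _ _ *:%R _) (GRing.Scale.Law.clone _ _ *:%R _)
    (@qmul R : H -> H -> H).
Proof.
split=> [p|p] a x y; change (@qmul R) with (@GRing.mul H).
  by rewrite /= mulrDl scalerAl.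
by rewrite /= mulrDr scalerAr.
Qed.

(* Attached to [qmul] because [*%R] already has a canonical bilinear structure,
   the one of numeric fields. *)
HB.instance Definition _ := bilinear_isBilinear.Build R H H H _ _
  (@qmul R) qmul_bilinear.

(** Reduces continuity of the product to that of its four real coordinates. *)
Lemma mkquatE x y z t : mkquat x y z t = x *: mkquat 1 0 0 0
  + y *: mkquat 0 1 0 0 + z *: mkquat 0 0 1 0 + t *: mkquat 0 0 0 1 :> H.
Proof. by apply: quatP; rewrite !qE; ring. Qed.

Lemma qmul_continuous : continuous (fun p : H * H => qmul p.1 p.2).
Proof.
move=> p.
have c1 l : (fun u : H * H => qcoord l u.1) @ p --> (qcoord l p.1).
  apply: (@continuous_comp _ _ _ fst (qcoord l)).
    exact: cvg_fst.
  exact: qcoord_continuous.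
have c2 l : (fun u : H * H => qcoord l u.2) @ p --> (qcoord l p.2).
  apply: (@continuous_comp _ _ _ snd (qcoord l)).
    exact: cvg_snd.
  exact: qcoord_continuous.
have cz (a : H * H -> R) (a' : R) (k : H) : a @ p --> a' ->
    (fun u => a u *: k) @ p --> a' *: k by exact: cvgZr_tmp.
have mk (a b c d : H * H -> R) (a' b' c' d' : R) :
    a @ p --> a' -> b @ p --> b' -> c @ p --> c' -> d @ p --> d' ->
    (fun u => mkquat (a u) (b u) (c u) (d u)) @ p --> mkquat a' b' c' d'.
  move=> ha hb hc hd; rewrite mkquatE; under eq_fun do rewrite mkquatE.
  exact: (cvgD (cvgD (cvgD (cz _ _ _ ha) (cz _ _ _ hb)) (cz _ _ _ hc))
               (cz _ _ _ hd)).
apply: mk.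
- by apply: cvgB; [apply: cvgB; [apply: cvgB|]|];
  apply: cvgM; (exact: c1 || exact: c2).
- by apply: cvgB; [apply: cvgD; [apply: cvgD|]|];
  apply: cvgM; (exact: c1 || exact: c2).
- by apply: cvgD; [apply: cvgD; [apply: cvgB|]|];
  apply: cvgM; (exact: c1 || exact: c2).
- by apply: cvgD; [apply: cvgB; [apply: cvgD|]|];
  apply: cvgM; (exact: c1 || exact: c2).
Qed.

Lemma c2qD (x y : R[i]) : c2q (x + y) = c2q x + c2q y.
Proof. by case: x y => [a b] [c d]; apply: quatP; rewrite !qE /=; ring. Qed.

Lemma c2qN (x : R[i]) : c2q (- x) = - c2q x.
Proof.
apply/eqP; rewrite -subr_eq0 opprK -c2qD addNr; apply/eqP; apply: quatP;
  by rewrite !qE /q0 /q1 /q2 /q3 mxE.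
Qed.

Lemma c2qM (x y : R[i]) : c2q (x * y) = c2q x * c2q y.
Proof.
case: x y => [a b] [c d]; apply: quatP; rewrite [in RHS]/GRing.mul /= /qmul;
  by rewrite !qE /=; ring.
Qed.

End Quaternions.

(** * Continuity and openness in charts *)

Section Charts.
Variables (R : realType) (T : topologicalType).
Implicit Types (c : chart R T) (A : set T).

Lemma param_dom c z : (coord c @` dom c) z -> dom c (param c z).
Proof. by move=> [x cx <-]; rewrite coordK. Qed.

Lemma paramK c z : (coord c @` dom c) z -> coord c (param c z) = z.
Proof. by move=> [x cx <-]; rewrite coordK. Qed.

Lemma param_continuous_at c z :
  (coord c @` dom c) z -> {for z, continuous (param c)}.
Proof.
move=> cz; have := param_continuous (c := c).
by rewrite continuous_open_subspace; [apply; rewrite inE|exact: img_open].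
Qed.

Lemma coord_continuous_at c x : dom c x -> {for x, continuous (coord c)}.
Proof.
move=> cx; have := coord_continuous (c := c).
by rewrite continuous_open_subspace; [apply; rewrite inE|exact: dom_open].
Qed.

(** Trades an image for a preimage under [param c], whose openness follows from continuity. *)
Lemma img_chartI c A :
  coord c @` (dom c `&` A) = (coord c @` dom c) `&` (param c @^-1` A).
Proof.
apply/seteqP; split => [_ [x [cx Ax] <-]|z [cz Az]].
  by split; [exists x | rewrite /= coordK].
by exists (param c z); [split => //; exact: param_dom | exact: paramK].
Qed.

Lemma open_img_chart c A : open A -> open (coord c @` (dom c `&` A)).
Proof.
move=> oA; rewrite img_chartI openE => z [cz Az].
apply: filterI; first exact: open_nbhs_nbhs (conj (img_open (c := c)) cz).
exact: (param_continuous_at cz (open_nbhs_nbhs (conj oA Az))).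
Qed.

End Charts.

(** * Calculus of smooth functions on a Riemann surface *)

Section Calculus.
Variables (R : realType) (S : riemannSurface R).
Implicit Types (V W : normedModType R) (X : tangent S).

Lemma smooth_differentiable V (h : S -> V) X : smooth h ->
  differentiable (h \o param (tchart X)) (coord (tchart X) (foot X)).
Proof.
move=> sh; have [dh _] := sh _ (tchart_atlas X) 1.
by apply: dh; exists (foot X) => //; exact: foot_dom.
Qed.

Lemma smooth_lin V W (L : {linear V -> W}) (h : S -> V) :
  continuous L -> smooth h -> smooth (L \o h).
Proof.
move=> Lc sh c ac k; apply: (Ck_lin (g := h \o param c)) => //; last exact: sh.
exact: img_open.
Qed.

Lemma smoothD V (g h : S -> V) :
  smooth g -> smooth h -> smooth (fun x => g x + h x).
Proof.
move=> sg sh c ac k.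
by apply: (CkD (g := g \o param c) (h := h \o param c));
  [exact: img_open|exact: sg|exact: sh].
Qed.

Lemma dD V (g h : S -> V) X :
  smooth g -> smooth h -> d (fun x => g x + h x) X = d g X + d h X.
Proof.
by move=> sg sh; apply: deriveD; apply: diff_derivable;
  exact: smooth_differentiable.
Qed.

Lemma smooth_bilin V V' W (B : {bilinear V -> V' -> W})
    (g : S -> V) (h : S -> V') :
  continuous (fun p => B p.1 p.2) -> smooth g -> smooth h ->
  smooth (fun x => B (g x) (h x)).
Proof.
move=> Bc sg sh c ac k.
by apply: (Ck_bilin (g := g \o param c) (h := h \o param c));
  [exact: img_open|exact: Bc|exact: sg|exact: sh].
Qed.

Lemma d_bilin V V' W (B : {bilinear V -> V' -> W})
    (g : S -> V) (h : S -> V') X :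
  continuous (fun p => B p.1 p.2) -> smooth g -> smooth h ->
  d (fun x => B (g x) (h x)) X =
    B (d g X) (h (foot X)) + B (g (foot X)) (d h X).
Proof.
move=> Bc sg sh.
have [_ +] := derive_bilin (vec X) Bc (smooth_differentiable X sg)
  (smooth_differentiable X sh).
by rewrite /= coordK; [|exact: foot_dom].
Qed.

Lemma smooth_cst V (a : V) : smooth (fun _ : S => a).
Proof.
move=> c _ k; elim: k a => [|k IH] a /=.
  by move=> z _; exact: cst_continuous.
split => [z _|v]; first exact: differentiable_cst.
(* The zero derivative is presented as a constant on the surface read in the chart, the form of the
   induction hypothesis. *)
rewrite (_ : 'D_v _ = (fun _ : S => 0 : V) \o param c); first exact: IH.
by apply/funext => z; exact: derive_cst.
Qed.

Lemma d_cst V (a : V) X : d (fun _ : S => a) X = 0.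
Proof. exact: derive_cst. Qed.

Lemma smooth_pair V W (g : S -> V) (h : S -> W) :
  smooth g -> smooth h -> smooth (fun x => (g x, h x)).
Proof.
move=> sg sh c ac k.
exact: (Ck_pair (img_open (c := c)) (sg c ac k) (sh c ac k)).
Qed.

Lemma d_pair V W (g : S -> V) (h : S -> W) X :
  smooth g -> smooth h -> d (fun x => (g x, h x)) X = (d g X, d h X).
Proof.
move=> sg sh; exact: (derive_pair _ (smooth_differentiable X sg)
  (smooth_differentiable X sh)).
Qed.

Lemma smooth_continuous V (h : S -> V) : smooth h -> continuous h.
Proof.
move=> sh x; have [c ac cx] := atlas_cover x.
have hp : {for coord c x, continuous (h \o param c)}.
  by apply: (sh c ac 0); exists x.
have : {for x, continuous ((h \o param c) \o coord c)}.
  by apply: continuous_comp => //; exact: coord_continuous_at.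
rewrite /prop_for /continuous_at /= coordK // => hx.
apply: cvg_trans hx; apply: near_eq_cvg.
have := open_nbhs_nbhs (conj (dom_open c) cx).
by apply: filterS => y cy; rewrite /= coordK.
Qed.

End Calculus.

(** * Quaternion-valued functions and constancy *)

Section Quat.
Variables (R : realType) (S : riemannSurface R).
Notation H := (quat R).
Implicit Types (g h : S -> H) (X : tangent S).

Lemma smoothM g h : smooth g -> smooth h -> smooth (fun x => g x * h x).
Proof.
move=> sg sh.
exact: (smooth_bilin (B := @qmul R : {bilinear H -> H -> H})
                     (@qmul_continuous R) sg sh).
Qed.

Lemma dM g h X : smooth g -> smooth h ->
  d (fun x => g x * h x) X = d g X * h (foot X) + g (foot X) * d h X.
Proof.
move=> sg sh.
exact: (d_bilin (B := @qmul R : {bilinear H -> H -> H}) X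
                (@qmul_continuous R) sg sh).
Qed.

(** The level set [B] of the value [h x0] is open since [h] is locally constant in charts, closed
    since [h] is continuous, and nonempty; connectedness concludes. *)
Lemma d0_constant h :
  smooth h -> (forall X, d h X = 0) -> exists n, forall x, h x = n.
Proof.
move=> sh dh0; have [x0 _] := surface_nonempty S.
exists (h x0) => x.
pose B := [set y : S | h y = h x0].
suff : B = [set: S] by move/seteqP => [_ /(_ x Logic.I)].
have oB : open B.
  rewrite openE => y By; have [c ac cy] := atlas_cover y.
  have ncy := open_nbhs_nbhs (conj (dom_open c) cy).
  have lc (l : 'I_4) : \forall z \near y, qcoord l (h z) = qcoord l (h y).
    have cdom : (coord c @` dom c) (coord c y) by exists y.
    have nz : \forall z \near coord c y,
        qcoord l ((h \o param c) z) = qcoord l ((h \o param c) (coord c y)).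
      apply: (derive0_locally_constant (img_open (c := c)) cdom
                                       (@qcoord_continuous R l)).
        by have [dh _] := sh c ac 1; exact: dh.
      move=> v z Uz; have := dh0 (Tangent ac (param_dom Uz) v).
      by rewrite /d /= paramK.
    have := coord_continuous_at cy nz; apply: filterS2 ncy => z cz.
    by rewrite /= !coordK.
  have : \forall z \near y, forall l, qcoord l (h z) = qcoord l (h y).
    exact: filter_forall.
  by apply: filterS => z hz; rewrite /B /= -By; apply/rowP => l; exact: hz.
apply: surface_connected; first by exists x0.
  by exists B => //; rewrite setTI.
exists B; last by rewrite setTI.
rewrite (_ : B = h @^-1` [set h x0]) //.
apply: closed_comp => [y _|]; first exact: smooth_continuous.
exact/accessible_closed_set1/hausdorff_accessible/norm_hausdorff.
Qed.

End Quat.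

(** * Functions and tangent vectors under a holomorphic map *)

Section Pullback.
Variables (R : realType) (S T : riemannSurface R) (p : S -> T).
Hypothesis hp : holomorphic p.

(** In charts [h \o p] is [h \o param c'] after the local expression of [p], but only where [p]
    lands in [dom c']; hence the reduction to single points. *)
Lemma smooth_pullback (V : normedModType R) (h : T -> V) :
  smooth h -> smooth (h \o p).
Proof.
have [pc ph] := hp.
move=> sh c ac k; apply/Ck_pointwise => z [x cx <-].
have [c' ac' cpx] := atlas_cover (p x).
pose A := p @^-1` dom c'.
have oA : open A by apply: open_comp (dom_open c') => y _; exact: pc.
have oU : open (coord c @` (dom c `&` A)) by exact: open_img_chart.
have Ucx : (coord c @` (dom c `&` A)) (coord c x) by exists x.
apply: (@Ck_sub _ _ _ _ (coord c @` (dom c `&` A))) => [_ -> //|].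
apply: (eq_Ck (g := (h \o param c') \o (coord c' \o p \o param c))) => //.
  move=> _ [y [cy Ay] <-] /=; rewrite !coordK //.
apply: (Ck_comp (U := coord c' @` dom c')) => //.
- by move=> _ [y [cy Ay] <-] /=; rewrite coordK //; exists (p y).
- exact: sh.
- by have [sw _] := ph c c' ac ac'; exact: sw.
Qed.

(** [Y] is the image of [X] under the differential of [p]. It is chosen before [h], so one vector
    serves both [f] and [N]; holomorphy gives the clause on [J]. *)
Lemma pushforward (X : tangent S) : exists Y : tangent T,
  foot Y = p (foot X) /\
  forall (V : normedModType R) (h : T -> V), smooth h ->
    d (h \o p) X = d h Y /\ d (h \o p) (J X) = d h (J Y).
Proof.
have [pc ph] := hp; case: X => c ac x cx v /=.
have [c' ac' cpx] := atlas_cover (p x).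
pose A := p @^-1` dom c'.
have oA : open A by apply: open_comp (dom_open c') => y _; exact: pc.
have oU : open (coord c @` (dom c `&` A)) by exact: open_img_chart.
have Ucx : (coord c @` (dom c `&` A)) (coord c x) by exists x.
have [sw wI] := ph c c' ac ac'.
pose w := coord c' \o p \o param c.
have dw : differentiable w (coord c x) by have [dw _] := sw 1; exact: dw.
have wx : w (coord c x) = coord c' (p x) by rewrite /w /= coordK.
exists (Tangent ac' cpx ('D_v w (coord c x))); split => // V h sh.
have chain u : 'D_u ((h \o p) \o param c) (coord c x)
    = 'D_('D_u w (coord c x)) (h \o param c') (coord c' (p x)).
  rewrite -wx -derive_comp //; last first.
    by rewrite wx; have [dh _] := sh c' ac' 1; apply: dh; exists (p x).
  apply: near_eq_derive; apply: filterS (open_nbhs_nbhs (conj oU Ucx)).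
  by move=> _ [y [cy Ay] <-] /=; rewrite !coordK.
by rewrite /d /= !chain wI.
Qed.

End Pullback.

(** * Noncommutative identities behind the two inverse maps and their derivatives *)

(* [A], [B], [c] stand for [(a - 1) / 2], [b / 2], [b / (a - 1)], and [D], [E]
   for the values of [df], [dN] at a tangent vector. *)
Section Algebra.
Variables (H : nzRingType) (N A B c : H).
Hypotheses (NN : N * N = -1) (cA : c * A = B) (Ac : A * c = B).
Hypotheses (cB : c * B = -1 - A) (Bc : B * c = -1 - A).

(** The terms [N * x * B] cancel because [A * c = B]; the remaining [- (x * A) - x * B * c] is [x]
    because [B * c = -1 - A]. *)
Lemma alphaK x : N * (N * x * A + x * B) - (N * x * A + x * B) * c = x.
Proof.
rewrite mulrDr mulrDl -!(mulrA _ _ c) Ac Bc !mulrA NN mulN1r mulrBr mulrN1.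
by rewrite mulNr opprD addrA addrK opprB addKr opprK.
Qed.

Lemma betaK x : N * (N * x - x * c) * A + (N * x - x * c) * B = x.
Proof.
rewrite mulrBr mulrA NN mulN1r !mulrBl -!mulrA cA cB mulrBr mulrN1 mulNr.
by rewrite addrA subrK opprB addKr opprK.
Qed.

Variables (D E : H).
Hypotheses (ND : N * D = - (D * N)) (NE : N * E = - (E * N)).

(** With alpha for [x], beta for [y] and [d alpha = - (D * y)], the left side is the Leibniz
    expansion of [d beta]. Moving [N] past [D] leaves [D * (N * y * A - y * B)], whose second factor
    is [x * A]. *)
Lemma beta_deriv x y : x = N * y - y * c ->
  E * x * A + N * (- (D * y)) * A + - (D * y) * B = (D + E) * x * A.
Proof.
move=> xE.
have xA : x * A = N * y * A - y * B by rewrite xE mulrBl -(mulrA y) cA.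
rewrite mulrN mulrA ND !mulNr opprK -addrA !mulrDl [RHS]addrC; congr (_ + _).
by rewrite -(mulrA D x) xA mulrBr !mulrA.
Qed.

(** With [d beta = (D + E) * x * A], the left side expands the differential of [N beta - beta c]. As
    [N] anticommutes with [D + E], it collapses to [E * y - (D + E) * y]. *)
Lemma alpha_deriv x y : y = N * x * A + x * B ->
  E * y + N * ((D + E) * x * A) - (D + E) * x * A * c = - (D * y).
Proof.
move=> yE; have NDE : N * (D + E) = - ((D + E) * N).
  by rewrite mulrDr mulrDl ND NE opprD.
rewrite !(mulrA N) NDE -(mulrA _ A c) Ac !mulNr -addrA -opprD -!mulrA -mulrDr.
by rewrite !mulrA -yE mulrDl opprD addrCA addrN addr0.
Qed.

End Algebra.

(** * Identities among the complex coefficients, transferred to the quaternions *)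

Section Coefficients.
Variables (R : realType) (mu : R[i]).
Hypotheses (mu0 : mu != 0) (mu1 : mu != 1).

Lemma coefa_neq1 : coefa mu - 1 != 0.
Proof.
have -> : coefa mu - 1 = (mu - 1) ^+ 2 / (2 * mu) by rewrite /coefa; field.
by rewrite mulf_neq0 ?expf_neq0 ?subr_eq0 // invr_neq0 // mulf_neq0 ?pnatr_eq0.
Qed.

(** A form of [a ^+ 2 + b ^+ 2 = 1]: on the unit circle [a] and [b] are the cosine and sine of the
    argument of [mu]. *)
Lemma coef_sqr : (coefa mu - 1) ^+ 2 + coefb mu ^+ 2 = - (2 * (coefa mu - 1)).
Proof.
rewrite /coefb !exprMn sqrCi /coefa; field.
exact: mu0.
Qed.

(** Moves the real factor inside the embedding, so that the identities below become field identities
    in C. *)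
Lemma c2q_half (z : R[i]) : 2^-1 *: c2q z = c2q (2^-1 * z).
Proof.
apply: (@scalerI _ _ (2 : R)); first by rewrite pnatr_eq0.
rewrite scalerA mulfV ?pnatr_eq0 // scale1r scaler_nat mulr2n -c2qD.
by congr c2q; field.
Qed.

Lemma c2q1 : c2q (1 : R[i]) = 1.
Proof. by []. Qed.

Let A := 2^-1 *: c2q (coefa mu - 1).
Let B := 2^-1 *: c2q (coefb mu).
Let c := c2q (coefb mu / (coefa mu - 1)).

Lemma coef_cA : c * A = B.
Proof.
rewrite /A /B !c2q_half /c -c2qM; congr c2q; field.
exact: coefa_neq1.
Qed.

Lemma coef_Ac : A * c = B.
Proof.
rewrite /A /B !c2q_half /c -c2qM; congr c2q; field.
exact: coefa_neq1.
Qed.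

(** The product is [b ^+ 2 / (2 * (a - 1))], which [coef_sqr] evaluates. *)
Lemma coef_cB : c * B = -1 - A.
Proof.
rewrite /A /B !c2q_half /c -c2qM -c2q1 -!c2qN -c2qD; congr c2q.
have : coefb mu ^+ 2 = - (2 * (coefa mu - 1)) - (coefa mu - 1) ^+ 2.
  by rewrite -coef_sqr addrC addKr.
move: coefa_neq1; move: (coefa mu - 1) (coefb mu) => x y x0 yy.
have -> : y / x * (2^-1 * y) = y ^+ 2 / (2 * x) by field.
by rewrite yy; field.
Qed.

Lemma coef_Bc : B * c = -1 - A.
Proof.
by rewrite -coef_cB /B c2q_half /c -!c2qM mulrC.
Qed.

End Coefficients.

(** * Parallel sections of the two families, compared on one surface *)

Section Connections.
Variables (R : realType) (S : riemannSurface R).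
Variables (f N : S -> quat R).
Notation H := (quat R).
Hypotheses (sf : smooth f) (sN : smooth N).
Hypothesis NN : forall x, N x * N x = -1.
Hypothesis dfJ : forall X : tangent S,
  star (d f) X = N (foot X) * d f X /\ star (d f) X = - (d f X * N (foot X)).
Hypothesis dfH : forall X : tangent S,
  d f X = - (2^-1 *: (d N X - N (foot X) * star (d N) X)).

Lemma N_df X : N (foot X) * d f X = - (d f X * N (foot X)).
Proof. by have [<- ->] := dfJ X. Qed.

(** Differentiate [N * N = -1]. *)
Lemma N_dN X : N (foot X) * d N X = - (d N X * N (foot X)).
Proof.
have := dM X sN sN.
rewrite (_ : (fun x => N x * N x) = fun _ => -1); last by apply/funext.
by rewrite d_cst => /esym/eqP; rewrite addrC addr_eq0 => /eqP.
Qed.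

(** The conformality relation of the parallel surface [f + N], whose Gauss map is [-N]. The mean
    curvature equation is solved for [d N (J X)], and [N] is moved to the right by
    anticommutation. *)
Lemma dg_star X : d (f \+ N) (J X) = (d f X + d N X) * N (foot X).
Proof.
have dDg Y : d (f \+ N) Y = d f Y + d N Y by exact: dD.
rewrite dDg.
have [_] := dfJ X; rewrite /star => ->.
have NdN : N (foot X) * d N (J X) = 2 *: d f X + d N X.
  rewrite [in RHS]dfH scalerN scalerA mulfV ?pnatr_eq0 // scale1r opprB.
  by rewrite subrK.
have -> : d N (J X) = - (N (foot X) * (2 *: d f X + d N X)).
  by rewrite -NdN mulrA NN mulN1r opprK.
rewrite mulrDr N_dN -scalerAr N_df scalerN opprD !opprK mulrDl addrA.
by congr (_ + _); rewrite scaler_nat mulr2n addKr.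
Qed.

Variable mu : R[i].
Let A : H := 2^-1 *: c2q (coefa mu - 1).
Let B : H := 2^-1 *: c2q (coefb mu).
Let c : H := c2q (coefb mu / (coefa mu - 1)).

(** The summands are one component of the (1,0) and (0,1) terms of [dS]. Half the sum of [mu - 1]
    and [mu^-1 - 1] is [a - 1]; half of ['i] times the second minus the first is [b]. *)
Lemma family_split (u w : H) :
  2^-1 *: (- (2^-1 *: u) - 2^-1 *: w * c2q 'i) * c2q (mu - 1)
  + 2^-1 *: (- (2^-1 *: u) + 2^-1 *: w * c2q 'i) * c2q (mu^-1 - 1)
  = - (u * A - w * B).
Proof.
have -> : A = 2^-1 *: (2^-1 *: (c2q (mu - 1) + c2q (mu^-1 - 1))).
  rewrite /A -c2qD [in RHS]c2q_half; congr (_ *: c2q _).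
  (* The identity is linear in [mu] and [mu^-1], so the inverse is treated as an independent
     variable. *)
  by rewrite /coefa; move: mu^-1 => nu; field.
have -> : B = 2^-1 *: (2^-1 *: (c2q 'i * (c2q (mu^-1 - 1) - c2q (mu - 1)))).
  rewrite /B -c2qN -c2qD -c2qM [in RHS]c2q_half; congr (_ *: c2q _).
  by rewrite /coefb; move: mu^-1 => nu; field.
move: (c2q 'i) (c2q (mu - 1)) (c2q (mu^-1 - 1)) => i L L'.
rewrite -!scalerAl -!scalerAr -scalerN -!scalerBr -!scalerDr -!scalerAl.
rewrite -scalerN -!scalerDr -scalerN; congr (_ *: (_ *: _)).
rewrite !mulrDl !mulrDr !mulNr !mulrN !opprD !opprK !mulrA.
by rewrite addrACA; congr (_ + _); rewrite addrC.
Qed.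

Lemma halfE (x y : H) :
  2^-1 *: (y * x * c2q (coefa mu - 1) + x * c2q (coefb mu)) = y * x * A + x * B.
Proof. by rewrite scalerDr !scalerAr. Qed.

Lemma dN_E alpha X : dN f N mu alpha X =
  d alpha X + d f X * (N (foot X) * alpha (foot X) * A + alpha (foot X) * B).
Proof. by rewrite /dN scalerAr halfE. Qed.

(** Both components share [T] because [starAhat] takes values in the line of [psi]; [dg_star]
    evaluates [Ahat], which involves [J X]. *)
Lemma dS_E (phi : S -> H * H) X :
  let x := foot X in
  let T := (d f X + d N X) * (N x * (phi x).2 * A - (phi x).2 * B) in
  dS f N mu phi X = ((d phi X).1 - f x * T, (d phi X).2 - T).
Proof.
move=> x T.
have dDg : d (f \+ N) X = d f X + d N X by exact: dD.
rewrite /dS /Ahat10 /Ahat01 /Ahat /starAhat /star /rmul dg_star dDg -/x.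
rewrite /T; move: (d f X + d N X) (d phi X) (phi x) => G [p1 p2] [v1 v2] /=.
have E1 := congr1 (+%R p1) (family_split (f x * (G * N x) * v2) (f x * G * v2)).
have E2 := congr1 (+%R p2) (family_split (G * N x * v2) (G * v2)).
rewrite addrA in E1; rewrite addrA in E2.
congr (_, _).
  by apply: etrans E1 _; rewrite !mulrBr !mulrA.
by apply: etrans E2 _; rewrite !mulrBr !mulrA.
Qed.

Hypotheses (mu0 : mu != 0) (mu1 : mu != 1).
Let cA := coef_cA mu0 mu1.
Let Ac := coef_Ac mu0 mu1.
Let cB := coef_cB mu0 mu1.
Let Bc := coef_Bc mu0 mu1.

(** By [beta_deriv] the [T] of [dS_E] equals [d beta], so the second component vanishes and the
    first reduces to [d alpha + df beta]. *)
Lemma dS_parallel_of_dN (alpha : S -> H) (n : H) : dN_parallel f N mu alpha ->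
  let beta x := N x * alpha x * A + alpha x * B in
  dS_parallel f N mu (fun x => (alpha x + n + f x * beta x, beta x)).
Proof.
move=> [sa pa] beta.
have sNa := smoothM sN sa.
have sNaA := smoothM sNa (smooth_cst A).
have saB := smoothM sa (smooth_cst B).
have sb : smooth beta by exact: smoothD sNaA saB.
have sfb := smoothM sf sb.
have san := smoothD sa (smooth_cst n).
have snu := smoothD san sfb.
have da X : d alpha X = - (d f X * beta (foot X)).
  by apply/eqP; rewrite -addr_eq0 -dN_E pa.
have alphaE x : alpha x = N x * beta x - beta x * c by rewrite alphaK.
have db X : d beta X = (d f X + d N X) * alpha (foot X) * A.
  rewrite (dD X sNaA saB) (dM X sNa (smooth_cst A)) (dM X sN sa).
  rewrite (dM X sa (smooth_cst B)) !d_cst !mulr0 !addr0 mulrDl da.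
  exact: (beta_deriv cA (d N X) (N_df X) (alphaE (foot X))).
split=> [|X]; first exact: smooth_pair.
rewrite dS_E (d_pair X snu sb) /=.
have -> : N (foot X) * beta (foot X) * A - beta (foot X) * B
    = alpha (foot X) * A.
  by rewrite [in RHS]alphaE mulrBl -(mulrA (beta _)) cA.
rewrite (mulrA (d f X + d N X)) -db (dD X san sfb) (dD X sa (smooth_cst n)).
rewrite (dM X sf sb) d_cst addr0.
by rewrite da addKr !subrr.
Qed.

(** The second component gives [d beta], hence [d alpha] by [alpha_deriv]. The first becomes
    [d (phi.1) = f d beta], and [n] is the constant value of [phi.1 - f beta - alpha]. *)
Lemma dN_parallel_of_dS (phi : S -> H * H) : dS_parallel f N mu phi ->
  let beta x := (phi x).2 in
  let alpha x := N x * beta x - beta x * c in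
  [/\ dN_parallel f N mu alpha,
      forall x, beta x = N x * alpha x * A + alpha x * B &
      exists n, forall x, (phi x).1 = alpha x + n + f x * beta x].
Proof.
move=> [sp pp] beta alpha.
have sb : smooth beta.
  have sndc : continuous (snd : H * H -> H) by move=> ?; exact: cvg_snd.
  exact: (smooth_lin (L := (snd : {linear (H * H)%type -> H})) sndc sp).
have sp1 : smooth (fun x => (phi x).1).
  have fstc : continuous (fst : H * H -> H) by move=> ?; exact: cvg_fst.
  exact: (smooth_lin (L := (fst : {linear (H * H)%type -> H})) fstc sp).
have phiE : phi = fun x => ((phi x).1, beta x).
  by apply/funext => x; exact: surjective_pairing.
have betaE x : beta x = N x * alpha x * A + alpha x * B by rewrite /alpha betaK.
(* Differences are written with constant factors, [-1] here and [- c] below, so that the sum and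
   product rules suffice. *)
have smf := smoothM (smooth_cst (-1 : H)) sf.
have smfb := smoothM smf sb.
have sNb := smoothM sN sb.
have sbc := smoothM sb (smooth_cst (- c)).
have sab := smoothD sNb sbc.
have alphaE : alpha = fun x => N x * beta x + beta x * - c.
  by apply/funext => x; rewrite mulrN.
have sa : smooth alpha by rewrite alphaE.
have aA x : N x * beta x * A - beta x * B = alpha x * A.
  by rewrite mulrBl -(mulrA (beta _)) cA.
have [dp1 db] : (forall X, d (fun x => (phi x).1) X = f (foot X) * d beta X) /\
    (forall X, d beta X = (d f X + d N X) * alpha (foot X) * A).
  suff dphi X : let T := (d f X + d N X) * alpha (foot X) * A in
      d (fun x => (phi x).1) X = f (foot X) * T /\ d beta X = T.
    by split=> X; have [e1 e2] := dphi X; rewrite ?e2.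
  have := pp X; rewrite dS_E aA (mulrA (d f X + d N X)).
  rewrite {1 2}phiE (d_pair X sp1 sb) /=.
  by case=> /eqP + /eqP; rewrite !subr_eq0 => /eqP ? /eqP ?.
have da X : d alpha X = - (d f X * beta (foot X)).
  rewrite alphaE (dD X sNb sbc) (dM X sN sb) (dM X sb (smooth_cst (- c))) d_cst.
  rewrite mulr0 addr0 mulrN db.
  exact: (alpha_deriv Ac (N_df X) (N_dN X) (betaE (foot X))).
split=> //; first by split=> // X; rewrite dN_E -betaE da addNr.
have sma := smoothM (smooth_cst (-1 : H)) sa.
have [X|n nE] := d0_constant (smoothD (smoothD sp1 smfb) sma).
  rewrite (dD X (smoothD sp1 smfb) sma) (dD X sp1 smfb) (dM X smf sb).
  rewrite (dM X (smooth_cst (-1 : H)) sf) (dM X (smooth_cst (-1 : H)) sa).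
  rewrite !d_cst !mul0r !add0r !mulN1r da opprK dp1 !mulNr.
  by rewrite addrCA subrr addr0 addNr.
exists n => x; rewrite -(nE x) !mulN1r mulNr.
by rewrite [alpha x + _]addrC subrK subrK.
Qed.

End Connections.

(** * Transfer to the universal cover, and both equivalences *)

Theorem theorem5p2 (R : realType) (M Mt : riemannSurface R) (p : Mt -> M)
    (f N : M -> quat R) (mu : R[i]) :
  universal_cover p -> cmc1 f N -> ~ in_round_sphere f ->
  mu != 0 -> mu != 1 ->
  let a := coefa mu in
  let b := coefb mu in
  let ft : Mt -> quat R := f \o p in
  let Nt : Mt -> quat R := N \o p in
  (forall phi : Mt -> quat R * quat R,
     dS_parallel ft Nt mu phi <->
     exists (n : quat R) (alpha beta : Mt -> quat R),
       [/\ dN_parallel ft Nt mu alpha,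
           forall x, beta x =
             2^-1 *: (Nt x * alpha x * c2q (a - 1) + alpha x * c2q b) &
           forall x, phi x = rmul e (alpha x + n) + rmul (psi ft x) (beta x)])
  /\
  (forall alpha : Mt -> quat R,
     dN_parallel ft Nt mu alpha <->
     exists nu beta : Mt -> quat R,
       dS_parallel ft Nt mu
         (fun x => rmul e (nu x) + rmul (psi ft x) (beta x)) /\
       forall x, alpha x = Nt x * beta x - beta x * c2q (b / (a - 1))).
Proof.
move=> [_ _ hp] [[sf _ _ _] [sN S2N dfJ] dfH] _ mu0 mu1 a b ft Nt.
have sft : smooth ft := smooth_pullback hp sf.
have sNt : smooth Nt := smooth_pullback hp sN.
have NN x : Nt x * Nt x = -1 by have [] := S2N (p x).
have dftJ (X : tangent Mt) : star (d ft) X = Nt (foot X) * d ft X /\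
    star (d ft) X = - (d ft X * Nt (foot X)).
  have [Y [Yx dY]] := pushforward hp X; have [e1 e2] := dY _ _ sf.
  by rewrite /star e1 e2 /Nt /= -Yx; exact: dfJ.
have dftH (X : tangent Mt) :
    d ft X = - (2^-1 *: (d Nt X - Nt (foot X) * star (d Nt) X)).
  have [Y [Yx dY]] := pushforward hp X.
  have [e1 _] := dY _ _ sf; have [e2 e3] := dY _ _ sN.
  by rewrite /star e1 e2 e3 /Nt /= -Yx; exact: dfH.
have fwd := dS_parallel_of_dN sft sNt NN dftJ dftH mu0 mu1.
have bwd := dN_parallel_of_dS sft sNt NN dftJ dftH mu0 mu1.
(* Converts between the frame [e], [psi] and the coordinate pairs of [fwd] and [bwd]. *)
have frameE x (u v : quat R) :
    rmul e u + rmul (psi ft x) v = (u + ft x * v, v).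
  by congr (_, _); rewrite /= ?mul1r ?mul0r ?add0r.
split=> [phi|alpha]; split.
- move=> /bwd[pa be [n ne]].
  pose alpha x := Nt x * (phi x).2 - (phi x).2 * c2q (b / (a - 1)).
  exists n, alpha, (fun x => (phi x).2); split; first exact: pa.
    by move=> x; rewrite halfE; exact: be.
  by move=> x; rewrite frameE -ne; case: (phi x).
- move=> [n [alpha [beta [pa be phiE]]]].
  have -> : phi = fun x => (alpha x + n + ft x * beta x, beta x).
    by apply/funext => x; rewrite phiE frameE.
  have betaE : beta = fun x =>
      Nt x * alpha x * (2^-1 *: c2q (a - 1)) + alpha x * (2^-1 *: c2q b).
    by apply/funext => x; rewrite be halfE.
  by rewrite betaE; exact: fwd.
(* The constant is free here; [0] gives [nu = alpha]. *)
- move=> pa; have := fwd alpha 0 pa.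
  set beta := fun x => Nt x * alpha x * _ + _ => pS.
  exists alpha, beta; split.
    have -> // : (fun x => rmul e (alpha x) + rmul (psi ft x) (beta x)) =
        fun x => (alpha x + 0 + ft x * beta x, beta x).
    by apply/funext => x; rewrite frameE addr0.
  move=> x; rewrite /beta alphaK //; [exact: coef_Ac|exact: coef_Bc].
- move=> [nu [beta [pS aE]]].
  have [pa _ _] := bwd _ pS.
  have -> : alpha = fun x => Nt x * beta x - beta x * c2q (b / (a - 1)).
    exact/funext.
  by move: pa; under eq_fun do rewrite frameE /=.
Qed.
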